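(* Let $L$ be a non-tabular tense logic. Then there exists an infinite rooted refined frame $\mathbb{F}$ such that $\mathbb{F}\models L$ (i.e. the class of finite rooted frames of $L$ differs from the class of rooted refined frames of $L$).
   Context: Tense formulas are built from variables, $\bot$, $\to$, a future necessity $\Box$ and a past possibility operator written here $\mathsf{P}$. A normal tense logic contains classical tautologies, is closed under modus ponens and substitution, and satisfies $\mathsf{P}\phi\to\psi\in L$ iff $\phi\to\Box\psi\in L$; it is tabular if it is the logic of a finite frame. A general frame is $(X,R,A)$ with $A\subseteq\mathcal{P}(X)$ containing $\varnothing$ and closed under $\cap$, complement, $R[\cdot]$ and $R^{-1}[\cdot]$; validity means truth at all points under all valuations into $A$. It is differentiated if any two distinct points are separated by some $U\in A$, tight if whenever $y\notin R[x]$ there are $U,V\in A$ with $x\in U\setminus R^{-1}[V]$ and $y\in V\setminus R[U]$, and refined if both. With $R_\sharp^0[x]=\{x\}$, $R_\sharp^{j+1}[x]=R_\sharp^j[x]\cup R[R_\sharp^j[x]]\cup R^{-1}[R_\sharp^j[x]]$, the frame is rooted if $X=\bigcup_jR_\sharp^j[x]$ for some $x$. *)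

(* Defs.v *)
From mathcomp Require Import all_boot.
From mathcomp Require Import boolp classical_sets functions cardinality.

Set Implicit Arguments.
Unset Strict Implicit.
Unset Printing Implicit Defensive.

Local Open Scope classical_set_scope.

Inductive form : Type :=
| Var of nat
| Bot
| Imp of form & form
| Box of form   (* future necessity *)
| Past of form. (* past possibility *)

Fixpoint fsubst (s : nat -> form) (phi : form) : form :=
  match phi with
  | Var n => s n
  | Bot => Bot
  | Imp a b => Imp (fsubst s a) (fsubst s b)
  | Box a => Box (fsubst s a)
  | Past a => Past (fsubst s a)
  end.

(* Formulas not headed by [Bot] or [Imp] are treated as propositional atoms,
   so this covers all tense instances of propositional tautologies. *)
Definition tautology (phi : form) : Prop :=
  forall v : form -> bool,
    v Bot = false -> (forall a b, v (Imp a b) = (v a ==> v b)) -> v phi.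

Record tense_logic (L : set form) : Prop := TenseLogic {
  logic_taut : forall phi, tautology phi -> L phi;
  logic_mp : forall phi psi, L (Imp phi psi) -> L phi -> L psi;
  logic_subst : forall s phi, L phi -> L (fsubst s phi);
  logic_adj : forall phi psi,
    L (Imp (Past phi) psi) <-> L (Imp phi (Box psi))
}.

(* The carrier may be empty; hence the inconsistent logic, being the logic of
   the empty frame, counts as tabular below. *)
Record kframe := KFrame {
  world :> Type;
  acc : world -> world -> Prop
}.

(* R[U] and R^{-1}[U] *)
Definition img (F : kframe) (U : set F) : set F :=
  [set y | exists2 x, U x & acc x y].
Definition preimg (F : kframe) (U : set F) : set F :=
  [set x | exists2 y, U y & acc x y].

Record gframe := GFrame {
  kripke :> kframe;
  adm : set (set kripke);
  adm0 : adm set0;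
  admI : forall U V, adm U -> adm V -> adm (U `&` V);
  admC : forall U, adm U -> adm (~` U);
  adm_img : forall U, adm U -> adm (img U);
  adm_preimg : forall U, adm U -> adm (preimg U)
}.

Fixpoint truth (F : kframe) (V : nat -> set F) (phi : form) : set F :=
  match phi with
  | Var n => V n
  | Bot => set0
  | Imp a b => [set x | truth V a x -> truth V b x]
  | Box a => [set x | forall y, acc x y -> truth V a y]
  | Past a => img (truth V a)
  end.

Definition kvalid (F : kframe) (phi : form) : Prop :=
  forall (V : nat -> set F) (x : F), truth V phi x.

Definition gvalid (F : gframe) (phi : form) : Prop :=
  forall V : nat -> set F, (forall n, adm (V n)) ->
  forall x : F, truth V phi x.

Definition gframe_of (L : set form) (F : gframe) : Prop :=
  forall phi, L phi -> gvalid F phi.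

Definition tabular (L : set form) : Prop :=
  exists F : kframe, finite_set [set: F] /\ L = [set phi | kvalid F phi].

Definition differentiated (F : gframe) : Prop :=
  forall x y : F, x <> y -> exists U, [/\ adm U, U x & ~ U y].

Definition tight (F : gframe) : Prop :=
  forall x y : F, ~ acc x y ->
    exists U V, [/\ adm U, adm V, (U `\` preimg V) x & (V `\` img U) y].

Definition refined (F : gframe) : Prop := differentiated F /\ tight F.

Fixpoint sharp (F : kframe) (j : nat) (x : F) : set F :=
  match j with
  | 0 => [set x]
  | j'.+1 => sharp j' x `|` img (sharp j' x) `|` preimg (sharp j' x)
  end.

Definition rooted (F : kframe) : Prop :=
  exists x : F, [set: F] = \bigcup_(j : nat) sharp j x.

(* Main.v *)
(** Both cases live on the canonical frame, whose points are the maximal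
    consistent extensions of [L] and whose admissible sets are the sets of
    points containing a given formula.  It is refined, and so are its
    connected components.  If all components have at most [N] points, every
    subset of a component is admissible, so each component is a Kripke frame
    for [L]; as there are finitely many frames on subsets of an [N]-element
    set, [L] is tabular.  Otherwise, for every [N] some component contains
    distinct points [s 0, ..., s N.-1] with [s i] at most [i] steps from the
    root.  Then the formulas "within [n] steps there is a point satisfying
    [p_n] and none of [p_0, ..., p_(n-1)]" are jointly consistent with [L],
    and a maximal consistent set containing all of them has an infinite
    component. *)
Require Import Defs.
From mathcomp Require Import all_boot.
From mathcomp Require Import boolp classical_sets functions cardinality.

Set Implicit Arguments.
Unset Strict Implicit.
Unset Printing Implicit Defensive.

Local Open Scope classical_set_scope.

(** * Theorems of a tense logic *)

Definition fneg (a : form) : form := Imp a Bot.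
Definition fdisj (a b : form) : form := Imp (fneg a) b.
Definition fconj (a b : form) : form := fneg (Imp a (fneg b)).

Ltac taut hL :=
  let v := fresh "v" in let v0 := fresh "v0" in let vI := fresh "vI" in
  apply: (logic_taut hL); intros v v0 vI;
    rewrite ?/fdisj ?/fconj ?/fneg ?(v0, vI);
  by repeat (match goal with |- context [v ?a] => case: (v a) end).

Lemma logic_syl L a b c : tense_logic L ->
  L (Imp a b) -> L (Imp b c) -> L (Imp a c).
Proof.
move=> hL ab bc; apply: (logic_mp hL) bc; apply: (logic_mp hL) ab.
by taut hL.
Qed.

Lemma logic_id L a : tense_logic L -> L (Imp a a).
Proof. by move=> hL; taut hL. Qed.

(** Necessitation is not among the closure rules; it follows from the adjunction, since [Past] of a
    tautology implies the theorem [a]. *)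
Lemma logic_nec L a : tense_logic L -> L a -> L (Box a).
Proof.
move=> hL La.
have top : L (Imp Bot Bot) by taut hL.
suff : L (Imp (Imp Bot Bot) (Box a)) by move=> /(logic_mp hL); apply.
by apply/(logic_adj hL)/(logic_mp hL _ La); taut hL.
Qed.

Lemma logic_past_box L a : tense_logic L -> L (Imp (Past (Box a)) a).
Proof. by move=> hL; apply/(logic_adj hL)/(logic_id _ hL). Qed.

Lemma logic_box_past L a : tense_logic L -> L (Imp a (Box (Past a))).
Proof. by move=> hL; apply/(logic_adj hL)/(logic_id _ hL). Qed.

Lemma logic_box_mono L a b : tense_logic L ->
  L (Imp a b) -> L (Imp (Box a) (Box b)).
Proof.
by move=> hL ab; apply/(logic_adj hL)/(logic_syl hL _ ab)/(logic_past_box _ hL).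
Qed.

Lemma logic_past_mono L a b : tense_logic L ->
  L (Imp a b) -> L (Imp (Past a) (Past b)).
Proof.
by move=> hL ab; apply/(logic_adj hL)/(logic_syl hL ab)/(logic_box_past _ hL).
Qed.

Lemma logic_box_K L a b : tense_logic L ->
  L (Imp (Box (Imp a b)) (Imp (Box a) (Box b))).
Proof.
move=> hL; set c := fconj (Box (Imp a b)) (Box a).
suff h : L (Imp c (Box b)) by apply: (logic_mp hL) h; rewrite /c; taut hL.
have pick d : L (Imp c (Box d)) -> L (Imp (Past c) d) by move/(logic_adj hL).
have hab : L (Imp (Past c) (Imp a b)) by apply: pick; rewrite /c; taut hL.
have ha : L (Imp (Past c) a) by apply: pick; rewrite /c; taut hL.
apply/(logic_adj hL)/(logic_mp hL _ ha)/(logic_mp hL _ hab).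
by taut hL.
Qed.

(** The K axiom for past necessity, the dual of [Past]. Contraposed and moved across the adjunction,
    it reduces to the unit [logic_box_past], applied to whichever of [Imp a b] and [a] fails. *)
Lemma logic_past_K L a b : tense_logic L ->
  L (Imp (fneg (Past (fneg (Imp a b)))) (Imp (fneg (Past (fneg a)))
      (fneg (Past (fneg b))))).
Proof.
move=> hL; set x := Past (fneg (Imp a b)); set y := Past (fneg a).
suff h : L (Imp (Past (fneg b)) (fdisj x y)) by apply: (logic_mp hL) h; taut hL.
apply/(logic_adj hL).
have hx : L (Imp (fneg (Imp a b)) (Box (fdisj x y))).
  by apply/(logic_syl hL (logic_box_past _ hL))/(logic_box_mono hL);
    rewrite -/x; taut hL.
have hy : L (Imp (fneg a) (Box (fdisj x y))).
  by apply/(logic_syl hL (logic_box_past _ hL))/(logic_box_mono hL);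
    rewrite -/y; taut hL.
by apply/(logic_mp hL _ hy)/(logic_mp hL _ hx); taut hL.
Qed.

Lemma logic_past_nec L a : tense_logic L -> L a -> L (fneg (Past (fneg a))).
Proof.
by move=> hL La; apply/(logic_adj hL)/(logic_mp hL _ La); taut hL.
Qed.

(** * Derivations and maximal consistent sets *)

(** Local consequence: necessitation acts only inside [L], which keeps the deduction theorem. *)
Inductive der (L G : set form) : form -> Prop :=
| der_hyp a : G a -> der L G a
| der_thm a : L a -> der L G a
| der_mp a b : der L G (Imp a b) -> der L G a -> der L G b.

Lemma der_sub L G H a : G `<=` H -> der L G a -> der L H a.
Proof.
move=> GH; elim=> [b /GH|b|b c _ hbc _]; [exact: der_hyp|exact: der_thm|].
exact: der_mp.
Qed.

Lemma der_deduction L G a b : tense_logic L ->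
  der L (G `|` [set a]) b -> der L G (Imp a b).
Proof.
move=> hL; elim=> [c [Gc|->]|c Lc|c d _ hcd _ hc].
- by apply: der_mp (der_hyp _ Gc); apply: der_thm; taut hL.
- by apply: der_thm; taut hL.
- by apply: der_mp (der_thm _ Lc); apply: der_thm; taut hL.
- by apply: der_mp hc; apply: der_mp hcd; apply: der_thm; taut hL.
Qed.

(** A derivation uses finitely many hypotheses, so one member of the chain supplies them all. The
    first alternative covers the empty chain. *)
Lemma der_chain L G (C : set (set form)) a : total_on C subset ->
  der L (\bigcup_(X in C) X `|` G) a ->
  der L G a \/ exists2 X, C X & der L (X `|` G) a.
Proof.
move=> totC; elim=> [b [[X CX Xb]|Gb]|b Lb|b c _ hbc _ hb].
- by right; exists X => //; apply: der_hyp; left.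
- by left; apply: der_hyp.
- by left; apply: der_thm.
- case: hbc hb => [hbc|[X CX hbc]] [hb|[Y CY hb]].
  + by left; apply: der_mp hb.
  + right; exists Y => //; apply: der_mp hb.
    by apply: der_sub hbc; exact: subsetUr.
  + right; exists X => //; apply: (der_mp hbc).
    by apply: der_sub hb; exact: subsetUr.
  + case: (totC _ _ CX CY) => XY.
    * by right; exists Y => //; apply: der_mp hb; apply: der_sub hbc;
        exact: setSU.
    * by right; exists X => //; apply: (der_mp hbc); apply: der_sub hb;
        exact: setSU.
Qed.

(** Maximality is implicit: commuting with [Imp] and omitting [Bot] forces each formula or its
    negation into the set. *)
Record mcs (L : set form) := Mcs {
  mem_mcs :> form -> Prop;
  mcs_logic : forall a, L a -> mem_mcs a;
  mcs_bot : ~ mem_mcs Bot;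
  mcs_imp : forall a b, mem_mcs (Imp a b) <-> (mem_mcs a -> mem_mcs b)
}.

Lemma mcs_ext L (w u : mcs L) : (forall a, w a <-> u a) -> w = u.
Proof.
case: w u => [w w1 w2 w3] [u u1 u2 u3] /= /predeqP e.
move: u1 u2 u3; rewrite -e => u1 u2 u3.
by congr Mcs; exact: Prop_irrelevance.
Qed.

Lemma mcs_mp L (w : mcs L) a b : w (Imp a b) -> w a -> w b.
Proof. by move/mcs_imp. Qed.

Lemma mcs_thm L (w : mcs L) a b : L (Imp a b) -> w a -> w b.
Proof. by move/(@mcs_logic _ w); exact: mcs_mp. Qed.

Lemma mcs_neg L (w : mcs L) a : w (fneg a) <-> ~ w a.
Proof. by split=> [/mcs_imp h /h/mcs_bot|h]; last apply/mcs_imp=> /h. Qed.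

Lemma lindenbaum L G : tense_logic L -> ~ der L G Bot ->
  exists w : mcs L, G `<=` w.
Proof.
move=> hL conG.
(* Zorn ranges over sets consistent together with [G], not over supersets of [G], because the union
   of the empty chain is empty. *)
have [|A [conA maxA]] := @Zorn_bigcup form (fun X => ~ der L (X `|` G) Bot).
  by move=> C sC totC /(der_chain totC) [//|[X /sC]].
have GA : G `<=` A.
  move=> a Ga; apply: contrapT => nAa; apply: (maxA (A `|` G)).
    by split;
      [exact: subsetUl|move=> /(_ a); apply: contra_not nAa; apply; right].
  by rewrite -setUA setUid.
have {}conA : ~ der L A Bot.
  by move=> h; apply: conA; apply: der_sub h; exact: subsetUl.
have derN a : ~ A a -> der L A (fneg a).
  move=> nAa; apply: (der_deduction hL); apply: contrapT => h.
  apply: (maxA (A `|` [set a])).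
    by split;
      [exact: subsetUl|move=> /(_ a); apply: contra_not nAa; apply; right].
  by move=> h'; apply: h; apply: der_sub h' => b [//|/GA]; left.
have derA a : der L A a -> A a.
  move=> ha; apply: contrapT => /derN hna; apply: conA; exact: der_mp ha.
unshelve eexists (@Mcs L A _ _ _) => //.
- by move=> a La; apply: derA; exact: der_thm.
- by move=> Abot; apply: conA; exact: der_hyp.
- move=> a b; split=> [Aab Aa|h].
    by apply: derA; apply: (der_mp (der_hyp _ Aab) (der_hyp _ Aa)).
  apply: derA; have [/h Ab|/derN nAa] := pselect (A a).
    by apply: der_mp (der_hyp _ Ab); apply: der_thm; taut hL.
  by apply: der_mp nAa; apply: der_thm; taut hL.
Qed.

Lemma der_set0 L a : tense_logic L -> der L set0 a -> L a.
Proof. by move=> hL; elim=> // b c _ + _; exact: logic_mp. Qed.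

Lemma mcs_refute L a : tense_logic L -> ~ L a -> exists w : mcs L, ~ w a.
Proof.
move=> hL nLa.
have [|w hw] := @lindenbaum L (set0 `|` [set fneg a]) hL; last first.
  by exists w; apply/mcs_neg/hw; right.
move=> /(der_deduction hL)/(der_set0 hL) h; apply: nLa.
by apply: (logic_mp hL) h; taut hL.
Qed.

(** * The canonical frame *)

Definition canon (L : set form) : kframe :=
  KFrame (fun w u : mcs L => forall a, w (Box a) -> u a).

Definition ext (L : set form) (a : form) : set (canon L) :=
  [set w : mcs L | w a].
Arguments ext L a : clear implicits.

(** If [Box a] is not in [w], then [fneg a] is consistent with all formulas boxed in [w]: by
    necessitation and K, a derivation of [a] from them would put [Box a] in [w]. *)
Lemma ext_box L a : tense_logic L ->
  ext L (Box a) = [set w | forall u, acc w u -> ext L a u].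
Proof.
move=> hL; apply/seteqP; split=> [w wa u|w hw]; first by move=> /(_ _ wa).
apply: contrapT => /= nwa.
pose S := [set b | (w : mcs L) (Box b)].
have [|u hu] := @lindenbaum L (S `|` [set fneg a]) hL; last first.
  have /mcs_neg : (u : mcs L) (fneg a) by apply: hu; right.
  by apply; apply: hw => b wb; apply: hu; left.
move=> /(der_deduction hL) hS; apply: nwa.
have {hS} : der L S a by apply: der_mp hS; apply: der_thm; taut hL.
elim=> [//|b Lb|b c _ hbc _ hb].
  by apply: mcs_logic; exact: logic_nec.
by apply: mcs_mp hb; apply: mcs_thm hbc; exact: logic_box_K.
Qed.

Lemma ext_past L a : tense_logic L -> ext L (Past a) = img (ext L a).
Proof.
move=> hL; apply/seteqP; split=> w; last first.
  by case=> u ua; apply; apply: mcs_thm ua; exact: logic_box_past.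
move=> wa.
(* [S] holds the formulas that are past-necessary at [w]. Any maximal consistent extension [u] of it
   is a predecessor of [w]: if [b] is not in [w], then [fneg (Box b)] lies in [S], since
   [Past (Box b)] implies [b]. *)
pose S := [set b | ~ (w : mcs L) (Past (fneg b))].
have [|u hu] := @lindenbaum L (S `|` [set a]) hL; last first.
  exists u; first by apply: hu; right.
  move=> b ub; apply: contrapT => nwb.
  suff /mcs_neg : (u : mcs L) (fneg (Box b)) by [].
  apply: hu; left => wb; apply: nwb; apply: mcs_thm wb.
  apply: (logic_syl hL _ (logic_past_box _ hL)); apply: (logic_past_mono hL).
  by taut hL.
move=> /(der_deduction hL) hS.
suff : forall b, der L S b -> ~ (w : mcs L) (Past (fneg b)).
  move=> /(_ _ hS); apply; apply: mcs_thm wa.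
  by apply: (logic_past_mono hL); taut hL.
move=> b; elim=> {b} [//|b Lb|b c _ hbc _ hb].
  by apply: (mcs_neg w _).1; exact/mcs_logic/(logic_past_nec hL).
move/(mcs_neg w _).2: hb => hb; move/(mcs_neg w _).2: hbc => hbc.
apply: (mcs_neg w _).1.
by apply: mcs_mp hb; apply: mcs_thm hbc; exact: logic_past_K.
Qed.

Lemma ext_neg L a : ext L (fneg a) = ~` ext L a.
Proof. by apply/seteqP; split=> w /=; move/mcs_neg. Qed.

(** The truth lemma for every admissible valuation at once: such a valuation amounts to a
    substitution. *)
Lemma truth_canon L (s : nat -> form) a : tense_logic L ->
  truth (fun n => ext L (s n)) a = ext L (fsubst s a).
Proof.
move=> hL; elim: a => [//||a iha b ihb|a iha|a iha] /=.
- by apply/seteqP; split=> w //= /mcs_bot.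
- rewrite iha ihb; apply/seteqP; split=> w /=; first by move=> h; apply/mcs_imp.
  by move/mcs_imp.
- by rewrite ext_box // iha.
- by rewrite ext_past // iha.
Qed.

Definition canon_adm (L : set form) : set (set (canon L)) :=
  [set U | exists a, U = ext L a].

Lemma canon_adm0 L : canon_adm (set0 : set (canon L)).
Proof. by exists Bot; apply/seteqP; split=> w //= /mcs_bot. Qed.

Lemma canon_admC L (U : set (canon L)) : canon_adm U -> canon_adm (~` U).
Proof. by case=> a ->; exists (fneg a); rewrite ext_neg. Qed.

Lemma canon_admI L (U V : set (canon L)) :
  canon_adm U -> canon_adm V -> canon_adm (U `&` V).
Proof.
case=> a -> [b ->]; exists (fconj a b).
rewrite /fconj ext_neg; apply/seteqP; split=> w /=.
  by case=> wa wb /mcs_imp /(_ wa) /mcs_neg.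
by move=> h; split; apply: contrapT => nw; apply: h; apply/mcs_imp => //;
  move=> _; apply/mcs_neg.
Qed.

Lemma canon_adm_img L (U : set (canon L)) : tense_logic L ->
  canon_adm U -> canon_adm (img U).
Proof. by move=> hL [a ->]; exists (Past a); rewrite ext_past. Qed.

Lemma canon_adm_preimg L (U : set (canon L)) : tense_logic L ->
  canon_adm U -> canon_adm (preimg U).
Proof.
move=> hL [a ->]; exists (fneg (Box (fneg a))).
rewrite ext_neg ext_box // ext_neg; apply/seteqP; split=> w /=.
  by case=> u ua wu /(_ u wu).
by move=> h; apply: contrapT => h'; apply: h => u wu ua; apply: h'; exists u.
Qed.

Definition canon_gframe L (hL : tense_logic L) : gframe :=
  @GFrame (canon L) (@canon_adm L) (canon_adm0 L) (@canon_admI L)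
    (@canon_admC L) (fun U => @canon_adm_img L U hL)
    (fun U => @canon_adm_preimg L U hL).

Lemma canon_valid L (hL : tense_logic L) : gframe_of L (canon_gframe hL).
Proof.
move=> a La V /choice[s hs] w.
have -> : V = fun n => ext L (s n) by apply/funext.
by rewrite truth_canon //; exact/mcs_logic/(logic_subst hL).
Qed.

Lemma canon_refined L (hL : tense_logic L) : refined (canon_gframe hL).
Proof.
split=> [w u wu|w u /existsNP[a /not_implyP[wa ua]]].
  have /existsNP[a wua] : ~ forall a, (w : mcs L) a <-> (u : mcs L) a.
    by move=> h; apply: wu; exact: mcs_ext.
  have [wa|nwa] := pselect ((w : mcs L) a).
    by exists (ext L a); split=> //; [exists a|move=> ua; apply: wua].
  exists (ext L (fneg a)); split=> //; [by exists (fneg a)|exact/mcs_neg|].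
  by move=> /mcs_neg nua; apply: wua.
(* Here [Box a] is in [w] and [a] is not in [u]; no point of the first set sees a point of the
   second. *)
exists (ext L (Box a)), (ext L (fneg a)); split;
  [by exists (Box a)| |split=> //|split].
- by exists (fneg a).
- by case=> v /mcs_neg va /(_ _ wa).
- exact/mcs_neg.
- by case=> v va /(_ _ va).
Qed.

(** * Morphisms and generated subframes *)

Record pmorphism (F G : kframe) (f : F -> G) : Prop := Pmorphism {
  pmorph_acc : forall x y, acc x y -> acc (f x) (f y);
  pmorph_succ : forall x z, acc (f x) z -> exists2 y, acc x y & f y = z;
  pmorph_pred : forall x z, acc z (f x) -> exists2 y, acc y x & f y = z
}.

Lemma pmorph_truth (F G : kframe) (f : F -> G) (V : nat -> set G) a :
  pmorphism f -> truth (fun n => f @^-1` V n) a = f @^-1` truth V a.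
Proof.
move=> [facc fsucc fpred].
elim: a => [//|//|a iha b ihb|a iha|a iha] /=; rewrite iha ?ihb //.
- apply/seteqP; split=> x /= h; last by move=> y /facc /h.
  by move=> z /fsucc[y /h hy <-].
- apply/seteqP; split=> x /=; first by case=> y ay /facc yx; exists (f y).
  by case=> z az /fpred[y yx yz]; exists y => //=; rewrite yz.
Qed.

Definition stable (F : kframe) (D : set F) : Prop :=
  forall x y, acc x y -> D x <-> D y.

Definition subkframe (F : kframe) (D : set F) : kframe :=
  @KFrame {x : F | D x} (fun x y => acc (sval x) (sval y)).

Definition incl (F : kframe) (D : set F) (x : subkframe D) : F := sval x.

Lemma incl_pmorphism (F : kframe) (D : set F) :
  stable D -> pmorphism (@incl F D).
Proof.
move=> sD; split=> // -[x Dx] z /= xz.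
  have Dz : D z by apply/(sD _ _ xz).
  by exists (exist _ z Dz).
have Dz : D z by apply/(sD _ _ xz).
by exists (exist _ z Dz).
Qed.

Lemma incl_inj (F : kframe) (D : set F) (x y : subkframe D) :
  incl x = incl y -> x = y.
Proof.
by case: x y => [x Dx] [y Dy] /= xy; apply: eq_exist.
Qed.

Definition sub_adm (F : gframe) (D : set F) : set (set (subkframe D)) :=
  [set U | exists2 W, adm W & U = @incl F D @^-1` W].

Lemma sub_adm0 (F : gframe) (D : set F) : sub_adm (set0 : set (subkframe D)).
Proof. by exists set0; [exact: adm0|]. Qed.

Lemma sub_admI (F : gframe) (D : set F) (U V : set (subkframe D)) :
  sub_adm U -> sub_adm V -> sub_adm (U `&` V).
Proof. by case=> A hA -> [B hB ->]; exists (A `&` B); [exact: admI|]. Qed.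

Lemma sub_admC (F : gframe) (D : set F) (U : set (subkframe D)) :
  sub_adm U -> sub_adm (~` U).
Proof. by case=> A hA ->; exists (~` A); [exact: admC|]. Qed.

Lemma img_incl (F : kframe) (D : set F) (W : set F) : stable D ->
  img (@incl F D @^-1` W) = @incl F D @^-1` img W.
Proof.
move=> /incl_pmorphism hp.
(* The image of [W] is the truth set of [Past (Var 0)] when the variable denotes [W]. *)
exact: (pmorph_truth (fun=> W) (Past (Var 0)) hp).
Qed.

Lemma preimg_incl (F : kframe) (D : set F) (W : set F) : stable D ->
  preimg (@incl F D @^-1` W) = @incl F D @^-1` preimg W.
Proof.
move=> /incl_pmorphism [_ hsucc _]; apply/seteqP; split=> x /=.
  by case=> y Wy xy; exists (incl y).
by case=> z Wz /hsucc[y xy yz]; exists y => //=; rewrite yz.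
Qed.

Lemma sub_adm_img (F : gframe) (D : set F) (sD : stable D)
  (U : set (subkframe D)) : sub_adm U -> sub_adm (img U).
Proof.
by case=> A hA ->; exists (img A); [exact: adm_img|exact: img_incl].
Qed.

Lemma sub_adm_preimg (F : gframe) (D : set F) (sD : stable D)
  (U : set (subkframe D)) : sub_adm U -> sub_adm (preimg U).
Proof.
by case=> A hA ->; exists (preimg A); [exact: adm_preimg|exact: preimg_incl].
Qed.

Definition subgframe (F : gframe) (D : set F) (sD : stable D) : gframe :=
  @GFrame (subkframe D) (@sub_adm F D) (sub_adm0 D) (@sub_admI F D)
    (@sub_admC F D) (sub_adm_img sD) (sub_adm_preimg sD).

Lemma sub_gvalid (F : gframe) (D : set F) (sD : stable D) a :
  gvalid F a -> gvalid (subgframe sD) a.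
Proof.
move=> Fa V hV x.
have /choice[W hW] : forall n, exists W, adm W /\ V n = @incl F D @^-1` W.
  by move=> n; case: (hV n) => W; exists W.
have -> : V = fun n => @incl F D @^-1` W n by apply/funext => n; case: (hW n).
rewrite (pmorph_truth _ _ (incl_pmorphism sD)).
by apply: Fa => n; case: (hW n).
Qed.

Lemma sub_refined (F : gframe) (D : set F) (sD : stable D) :
  refined F -> refined (subgframe sD).
Proof.
move=> [dF tF]; split=> [x y xy|x y xy].
  have [|U [aU Ux Uy]] := dF (incl x) (incl y).
    by move=> /(@incl_inj F D).
  by exists (@incl F D @^-1` U); split => //; exists U.
have [U [V [aU aV [Ux Vx] [Vy Uy]]]] := tF (incl x) (incl y) xy.
exists (@incl F D @^-1` U), (@incl F D @^-1` V); split.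
- by exists U.
- by exists V.
- by rewrite preimg_incl.
- by rewrite img_incl.
Qed.

(** * Connected components and the growth of balls *)

Definition component (F : kframe) (x : F) : set F :=
  \bigcup_(j : nat) sharp j x.

Lemma sharp_step (F : kframe) (x y z : F) j :
  sharp j x y -> acc y z \/ acc z y -> sharp j.+1 x z.
Proof.
by move=> xy [yz|zy]; [left; right; exists y|right; exists y].
Qed.

Lemma sharp_mono (F : kframe) (x : F) i j :
  i <= j -> sharp i x `<=` sharp j x.
Proof.
move=> /subnK <-; elim: (j - i) => [//|k ih] y /ih.
by rewrite addSn; left; left.
Qed.

Lemma component_stable (F : kframe) (x : F) : stable (component x).
Proof.
move=> y z yz; split=> -[j _ h]; exists j.+1 => //; apply: sharp_step h _.
  by left.
by right.
Qed.

Lemma component_root (F : kframe) (x : F) : component x x.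
Proof. by exists 0. Qed.

Lemma sharp_incl (F : kframe) (D : set F) (x : subkframe D) j : stable D ->
  sharp j x = @incl F D @^-1` sharp j (incl x).
Proof.
move=> sD; elim: j => [|j ih] /=.
  by apply/seteqP; split=> y /= => [->|/incl_inj].
by rewrite ih img_incl // preimg_incl.
Qed.

Lemma component_rooted (F : kframe) (x : F) : rooted (subkframe (component x)).
Proof.
exists (exist _ x (component_root x)); apply/seteqP; split=> // -[y Dy] _.
have [j _ xy] := Dy.
by exists j => //; rewrite sharp_incl //; exact: component_stable.
Qed.

(* A ball that adds no point to the previous one is already the whole
   component, so either a new point appears at each distance or the component
   is exhausted. *)
Lemma component_cases (F : kframe) (x : F) n :
  (exists s : nat -> F, forall i, i < n ->
     sharp i x (s i) /\ forall j, j < i -> s j <> s i)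
  \/ (exists s : nat -> F, component x `<=` s @` `I_n).
Proof.
elim: n => [|n [[s hs]|[s hs]]].
- by left; exists (fun=> x).
- have [[y xy sy]|h] := pselect (exists2 y, sharp n x y & ~ (s @` `I_n) y).
    left; exists (fun i => if i < n then s i else y) => i; rewrite ltnS => lein.
    case: ltnP => ltin.
      have [? sij] := hs _ ltin; split=> // j ltji.
      by rewrite (ltn_trans ltji ltin); exact: sij.
    have ->: i = n by apply/eqP; rewrite eqn_leq lein.
    by split=> // j ltjn; rewrite ltjn => sjy; apply: sy; exists j.
  have ball : sharp n x `<=` s @` `I_n.
    by move=> y xy; apply: contrapT => sy; apply: h; exists y.
  right; exists s => y [j _ xy].
  suff [i ltin <-] : (s @` `I_n) y by exists i => //; exact: ltnW.
  move: xy; have [lejn|/ltnW lenj] := leqP j n.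
    by move/(sharp_mono lejn)/ball.
  have sub k : sharp (k + n) x `<=` s @` `I_n.
    elim: k => [|k ih]; first exact: ball.
    (* The listed points are closed under neighbours: [s i] lies in the ball of radius [i < n], so
       its neighbours lie in the ball of radius [n], which is already listed. *)
    have next z t : sharp (k + n) x z -> acc z t \/ acc t z -> (s @` `I_n) t.
      move=> /ih[i ltin <-] zt; apply: ball; apply: (sharp_mono ltin).
      by apply: sharp_step zt; have [] := hs i ltin.
    move=> z [[/ih//|[t xt tz]]|[t xt zt]]; apply: next xt _; first by left.
    by right.
  by rewrite -(subnK lenj) => /sub.
- by right; exists s => y /hs[i /ltnW ? <-]; exists i.
Qed.

(** * Frames with bounded components *)

Lemma separating (F : gframe) (s : nat -> F) (x : F) n : differentiated F ->
  exists U, [/\ adm U, U x & forall i, i < n -> s i <> x -> ~ U (s i)].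
Proof.
move=> dF; elim: n => [|n [U [aU Ux hU]]].
  by exists (~` set0); split; [exact/admC/adm0|case|].
have [snx|snx] := pselect (s n = x).
  exists U; split=> // i; rewrite ltnS leq_eqVlt => /orP[/eqP ->//|]; exact: hU.
have [W [aW Wx Wn]] := dF x (s n) (fun e => snx (esym e)).
exists (U `&` W); split=> //; first exact: admI.
move=> i; rewrite ltnS leq_eqVlt => /orP[/eqP -> _ []//|lt_in six [Ui _]].
exact: hU Ui.
Qed.

(** In a finite differentiated frame [separating] makes singletons admissible, and [P] is a finite
    union of them, collected along the enumeration. *)
Lemma finite_adm (F : gframe) (s : nat -> F) n (P : set F) : differentiated F ->
  (forall x, exists2 i, i < n & s i = x) -> adm P.
Proof.
move=> dF sF.
suff part k : k <= n -> exists U, [/\ adm U, U `<=` P &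
    forall i, i < k -> P (s i) -> U (s i)].
  have [U [aU UP PU]] := part n (leqnn n).
  suff -> : P = U by [].
  apply/seteqP; split=> // x; have [i ltin <-] := sF x; exact: PU.
elim: k => [_|k ih /ltnW /ih[U [aU UP PU]]].
  by exists set0; split; [exact: adm0|move=> ? []|].
have [Pk|nPk] := pselect (P (s k)); last first.
  by exists U; split=> // i; rewrite ltnS leq_eqVlt => /orP[/eqP ->//|];
    exact: PU.
have [W [aW Wk hW]] := separating s (s k) n dF.
(* The union of [U] and [W], by De Morgan. *)
exists (~` (~` U `&` ~` W)); split.
- by apply/admC/admI; exact: admC.
- move=> x h; have [Ux|nUx] := pselect (U x); first exact: UP.
  have [i ltin six] := sF x.
  suff -> : x = s k by [].
  apply: contrapT => xsk; apply: h; split=> //=.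
  by rewrite -six; apply: hW => //; rewrite six.
- move=> i; rewrite ltnS leq_eqVlt => /orP[/eqP -> _ []//|ltik Pi [] /(_ _)].
  by move=> nU _; apply/nU/PU.
Qed.

(* The disjoint union of all frames on ['I_n], each coded by its relation. *)
Definition coded (n : nat) : kframe :=
  @KFrame ({ffun 'I_n * 'I_n -> bool} * 'I_n)
    (fun x y => x.1 = y.1 /\ x.1 (x.2, y.2)).

Definition locally_valid (L : set form) (F : kframe) : set F :=
  [set x | forall a, L a -> forall V, truth V a x].
Arguments locally_valid L F : clear implicits.

(** Future necessitation carries validity of [L] to successors, past necessitation to
    predecessors. *)
Lemma locally_valid_stable L (F : kframe) : tense_logic L ->
  stable (locally_valid L F).
Proof.
move=> hL x y xy; split=> h a La V.
  exact: (h _ (logic_nec hL La)).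
apply: contrapT => nVa; apply: (h _ (logic_past_nec hL La) V).
by exists x.
Qed.

Lemma embed_coded (F : kframe) (s : nat -> F) n :
  (forall x, exists2 i, i < n & s i = x) ->
  exists2 f : F -> coded n, pmorphism f & injective f.
Proof.
move=> sF.
have /choice[g hg] : forall x, exists i : 'I_n, s i = x.
  by move=> x; have [i ltin <-] := sF x; exists (Ordinal ltin).
(* [r] is the accessibility relation transported along the index choice [g]. It relates only chosen
   indices, so the image of [F] is closed under neighbours in its summand. *)
pose r : {ffun 'I_n * 'I_n -> bool} := [ffun p : 'I_n * 'I_n =>
  `[< exists x y, [/\ g x = p.1, g y = p.2 & acc x y] >]].
have ginj : injective g by move=> x y gxy; rewrite -(hg x) gxy hg.
exists (fun x => (r, g x)); last by move=> x y [/ginj].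
split=> [x y xy|x z|x z] /=.
- by split=> //; rewrite ffunE; apply/asboolP; exists x, y.
- case: z => q k [/= <-]; rewrite ffunE => /asboolP[y [z [/= /ginj-> <- yz]]].
  by exists z.
- case: z => q k [/= ->]; rewrite ffunE => /asboolP[y [z [/= <- /ginj-> yz]]].
  by exists y.
Qed.

(** One finite frame does for all non-theorems: each countermodel embeds as a generated subframe of
    [coded n], inside the part where [L] is locally valid. *)
Lemma bounded_tabular L n : tense_logic L ->
  (forall a, ~ L a -> exists (F : kframe) (s : nat -> F),
     [/\ forall x, exists2 i, i < n & s i = x,
         forall b, L b -> kvalid F b & ~ kvalid F a]) ->
  tabular L.
Proof.
move=> hL hF; have sD := @locally_valid_stable L (coded n) hL.
pose T : finType := ({ffun 'I_n * 'I_n -> bool} * 'I_n)%type.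
exists (subkframe (locally_valid L (coded n))); split.
  apply: (@finite_preimage _ T setT (@incl (coded n) _)).
    by move=> x y _ _; exact: (@incl_inj (coded n) _ x y).
  exact: finite_finset.
apply/seteqP; split=> [a La V x|a /= ha].
  pose W m := @incl (coded n) (locally_valid L (coded n)) @` V m.
  have -> : V = fun m => @incl (coded n) _ @^-1` W m.
    apply/funext => m; apply/seteqP; split=> y /=; first by move=> Vy; exists y.
    by case=> z Vz /incl_inj <-.
  by rewrite (pmorph_truth _ _ (incl_pmorphism sD)); exact: (svalP x).
apply: contrapT => /hF[F [s [sF LF]]]; apply=> V x.
have [f fp finj] := embed_coded sF.
have fx : locally_valid L (coded n) (f x).
  move=> b Lb W; suff : (f @^-1` truth W b) x by [].
  by rewrite -(pmorph_truth _ _ fp); exact: LF.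
(* By injectivity every valuation on [F] is pulled back from [coded n], so truth can be compared
   there. *)
have -> : V = fun m => f @^-1` (f @` V m).
  apply/funext => m; apply/seteqP; split=> y /=; first by move=> Vy; exists y.
  by case=> z Vz /finj <-.
rewrite (pmorph_truth _ _ fp) /=.
have := ha (fun m => @incl (coded n) _ @^-1` (f @` V m)) (exist _ (f x) fx).
by rewrite (pmorph_truth _ _ (incl_pmorphism sD)).
Qed.

Lemma fsubst_Var a : fsubst Var a = a.
Proof. by elim: a => //= [a -> b ->|a ->|a ->]. Qed.

Lemma bounded_components_tabular L n (hL : tense_logic L) :
  (forall x : canon L, exists s : nat -> canon L,
     component x `<=` s @` `I_n) -> tabular L.
Proof.
move=> hn; apply: (@bounded_tabular L n hL) => a /(mcs_refute hL)[w nwa].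
have [s hs] := hn w.
pose D := @component (canon L) w; have sD := @component_stable (canon L) w.
pose G := @subgframe (canon_gframe hL) D sD.
have [dG _] : refined G by apply: sub_refined; exact: canon_refined.
have root : D w by exact: component_root.
have [t ht] : exists t : nat -> G, forall x, exists2 i, i < n & t i = x.
  (* The list [s] may leave the component; the root serves as default value. *)
  exists (fun i => if pselect (D (s i)) is left h then exist _ (s i) h
                   else exist _ w root).
  move=> [x Dx]; have [i ltin six] := hs x Dx; exists i => //.
  by case: pselect => [h|]; [exact: eq_exist|rewrite six].
exists G, t; split=> //.
  move=> b Lb V; have Gb : gvalid G b := sub_gvalid (@canon_valid L hL b Lb).
  apply: Gb => m.
  (* All subsets of the finite component are admissible, so general validity becomes Kripke
     validity. *)
  exact: finite_adm dG ht.
move=> /(_ (fun m => @incl (canon L) D @^-1` ext L (Var m)) (exist _ w root)).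
rewrite (pmorph_truth _ _ (incl_pmorphism sD)) truth_canon //=.
by rewrite fsubst_Var.
Qed.

(** * Unbounded components *)

(** The disjunction says that [a] holds here, at a predecessor or at a successor. It is inserted
    innermost, matching [sharp], which extends paths at their far end. *)
Fixpoint within (j : nat) (a : form) : form :=
  if j is k.+1 then
    within k (fdisj a (fdisj (Past a) (fneg (Box (fneg a)))))
  else a.

Lemma truth_within (F : kframe) (V : nat -> set F) j a x :
  truth V (within j a) x <-> exists2 y, sharp j x y & truth V a y.
Proof.
elim: j a => [|j ih] a /=; first by split=> [|[y ->]]; [exists x|].
rewrite ih; split=> [[y xy /= h]|[y [[xy|[z xz zy]]|[z xz yz]] ay]].
- have [ay|nay] := pselect (truth V a y); first by exists y => //; left; left.
  have [[z az zy]|nz] := pselect (img (truth V a) y).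
    by exists z => //; apply: sharp_step xy _; right.
  apply: contrapT => h'; apply: (h nay nz) => z yz az; apply: h';
    exists z => //.
  by apply: sharp_step xy _; left.
- by exists y => // na; case: (na ay).
- by exists z => // _ _ h; case: (h y zy ay).
- by exists z => // _ nP; case: nP; exists y.
Qed.

Fixpoint fresh (n k : nat) : form :=
  if k is j.+1 then fconj (fresh n j) (fneg (Var j)) else Var n.

Lemma truth_fresh (F : kframe) (V : nat -> set F) n k x :
  truth V (fresh n k) x <-> V n x /\ forall j, j < k -> ~ V j x.
Proof.
elim: k => [|k ih]; first by split=> [|[]].
have -> : truth V (fresh n k.+1) x <-> truth V (fresh n k) x /\ ~ V k x.
  rewrite /=; split=> [h|[h1 h2] h]; last exact: h h1 h2.
  by split; apply: contrapT => nh; apply: h => //= h _; apply: nh.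
rewrite ih; split=> [[[Vn h] Vk]|[Vn h]].
  by split=> // j; rewrite ltnS leq_eqVlt => /orP[/eqP ->//|]; exact: h.
by split; [split=> // j ltjk; apply: h; exact: ltnW|exact: h].
Qed.

(** The radius equals the index because [component_cases] finds its point [s n] within distance
    [n]. *)
Definition spread (n : nat) : form := within n (fresh n n).

Lemma spread_infinite (F : kframe) (V : nat -> set F) x :
  (forall n, truth V (spread n) x) ->
  infinite_set [set: subkframe (component x)].
Proof.
move=> h.
have /choice[y hy] : forall n, exists y : subkframe (component x),
    V n (incl y) /\ forall j, j < n -> ~ V j (incl y).
  move=> n; have /truth_within[y xy /truth_fresh hy] := h n.
  by exists (exist _ y (ex_intro2 _ _ n I xy)).
have yinj i j : i < j -> y i <> y j.
  by move=> ltij yij; have [_ /(_ i ltij)] := hy j; apply; rewrite -yij;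
    case: (hy i).
move=> fin; apply: infinite_nat.
apply: (@finite_preimage _ _ setT y) fin => i j _ _ yij.
by case: (ltngtP i j) => // /yinj; rewrite yij.
Qed.

(** Replace each variable by a formula separating [s i] from the other listed points. The formulas
    whose instance holds at [w] include [L] and the given [spread i] and are closed under modus
    ponens, but omit [Bot]. *)
Lemma spread_consistent L (hL : tense_logic L) n (w : canon L)
    (s : nat -> canon L) :
  (forall i, i < n -> sharp i w (s i) /\ forall j, j < i -> s j <> s i) ->
  ~ der L [set a | exists2 i, i < n & a = spread i] Bot.
Proof.
move=> hs.
have /choice[p hp] : forall i, exists a,
    ext L a (s i) /\ forall j, j < n -> s j <> s i -> ~ ext L a (s j).
  move=> i; have [U [[a ->] ai hU]] :=
    @separating (canon_gframe hL) s (s i) n (canon_refined hL).1.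
  by exists a.
suff h a : der L [set a | exists2 i, i < n & a = spread i] a ->
    ext L (fsubst p a) w by move=> /h /mcs_bot.
elim=> {a} [a [i ltin ->]|a La|a b _ hab _ ha].
- rewrite -truth_canon //; have [wi si] := hs i ltin.
  apply/truth_within; exists (s i) => //; apply/truth_fresh.
  split=> [|j ltji]; first by case: (hp i).
  by have [_] := hp j; apply=> // /esym; exact: si.
- exact/mcs_logic/(logic_subst hL).
- exact: mcs_mp hab ha.
Qed.

Lemma der_spread L a : der L (range spread) a ->
  exists n, der L [set b | exists2 i, i < n & b = spread i] a.
Proof.
have mono m n b : m <= n -> der L [set b | exists2 i, i < m & b = spread i] b ->
    der L [set b | exists2 i, i < n & b = spread i] b.
  by move=> lemn; apply: der_sub => c [i ltim ->]; exists i => //;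
    exact: leq_trans lemn.
elim=> {a} [a [i _ <-]|a La|a b _ [m hm] _ [n hn]].
- by exists i.+1; apply: der_hyp; exists i.
- by exists 0; exact: der_thm.
- exists (maxn m n); apply: der_mp (mono _ _ _ _ hm) (mono _ _ _ _ hn).
    exact: leq_maxl.
  exact: leq_maxr.
Qed.

Theorem theorem2p18 (L : set form) (hL : tense_logic L) (hnt : ~ tabular L) :
  exists F : gframe,
    [/\ infinite_set [set: F], rooted F, refined F & gframe_of L F].
Proof.
have [|w hw] := @lindenbaum L (range spread) hL.
  (* An inconsistency would involve only the first [n] formulas. Either all components have at most
     [n] points, contradicting non-tabularity, or a larger one makes these formulas consistent. *)
  move=> /der_spread[n]; have [h|/existsNP[w hw]] :=
    pselect (forall x : canon L, exists s : nat -> canon L,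
      component x `<=` s @` `I_n).
    by case: hnt; exact: bounded_components_tabular h.
  have [[s hs]|//] := component_cases w n.
  exact: spread_consistent hs.
exists (@subgframe (canon_gframe hL) _ (@component_stable (canon L) w)); split.
(* Under the canonical valuation, membership in [w] is truth at [w], so every [spread n] is true
   there. *)
- apply: (@spread_infinite (canon L) (fun n => ext L (Var n))) => n.
  rewrite truth_canon //.
  by rewrite fsubst_Var; apply: hw; exists n.
- exact: component_rooted.
- exact/sub_refined/canon_refined.
- by move=> a La; apply: sub_gvalid; exact: canon_valid.
Qed.
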